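(* Let $q$ be a power of a prime number $p$, let $r\ge 2$ be an integer and let $K$ be a field extension of $\mathbb{F}_q(t)$ such that $\mathbb{F}_q$ is algebraically closed in $K$. Let $\mathbf{a},\mathbf{b}\in K$ and let $\Phi:\mathbb{F}_q[t]\to \mathrm{End}_{K(z)}(\mathbb{G}_a)$ be the family of Drinfeld modules given by $$\Phi_t(x)=tx+z x^q + x^{q^r}.$$ Then there exist infinitely many $\lambda\in\overline{K}$ such that both $\mathbf{a}$ and $\mathbf{b}$ are torsion points for $\Phi^\lambda$ if and only if $\mathbf{a}$ and $\mathbf{b}$ are linearly dependent over $\mathbb{F}_q$.
   Context: $\overline{K}$ is an algebraic closure of $K$ and $K(z)$ is the rational function field in $z$ over $K$. For a field $L\supseteq\mathbb{F}_q(t)$, a Drinfeld $\mathbb{F}_q[t]$-module over $L$ is an $\mathbb{F}_q$-algebra homomorphism $\Phi:\mathbb{F}_q[t]\to\mathrm{End}_L(\mathbb{G}_a)$, $a\mapsto\Phi_a$ (here $\mathrm{End}_L(\mathbb{G}_a)$ is the ring of additive polynomials over $L$ in the variable $x$ under addition and composition, and $c\in\mathbb{F}_q$ acts as $\Phi_c(x)=cx$), with $\Phi_t(x)=tx+\sum_{i=1}^{r-1}a_ix^{q^i}+x^{q^r}$, $a_i\in L$; it is determined by $\Phi_t$. A point $x\in\overline{L}$ is torsion for $\Phi$ if $\Phi_a(x)=0$ for some nonzero $a\in\mathbb{F}_q[t]$. For $\lambda\in\overline{K}$, $\Phi^\lambda$ denotes the Drinfeld module obtained by specializing $z=\lambda$,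 i.e. $\Phi^\lambda_t(x)=tx+\lambda x^q+x^{q^r}$. *)

(* Defs.v *)
From HB Require Import structures.
From mathcomp Require Import all_boot all_order all_algebra all_field.
From mathcomp Require Import boolp classical_sets cardinality.

Set Implicit Arguments.
Unset Strict Implicit.
Unset Printing Implicit Defensive.

Import GRing.Theory.
Local Open Scope ring_scope.

Section AdditivePolynomials.
Variable L : fieldType.

(* In [{poly {poly L}}] the outer variable is X and the inner one is Y, so this
   is the polynomial identity p(X + Y) = p(X) + p(Y). *)
Definition additive_poly : {pred {poly L}} :=
  fun p => poly_XaY p == p^:P + p%:P.

Lemma additive_polyP p :
  reflect (poly_XaY p = p^:P + p%:P) (p \in additive_poly).
Proof. exact: eqP. Qed.

Lemma additive_poly_horner (S : comNzRingType) (f : {rmorphism L -> S}) p u v :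
  p \in additive_poly ->
  (map_poly f p).[u + v] = (map_poly f p).[u] + (map_poly f p).[v].
Proof.
move/additive_polyP=> hp.
have [g gX gC] : exists2 g : {rmorphism {poly L} -> S},
    g 'X = v & forall c, g c%:P = f c.
  exists (horner_eval v \o map_poly f).
    by rewrite /= map_polyX /horner_eval hornerX.
  by move=> c; rewrite /= map_polyC /horner_eval hornerC.
have gmap q : map_poly g q^:P = map_poly f q.
  by rewrite -map_poly_comp; apply: eq_map_poly => c; rewrite -gC.
have gXY : map_poly g ('X + 'Y) = 'X + v%:P.
  by rewrite rmorphD /= map_polyX map_polyC /= gX.
have gp : g p = (map_poly f p).[v].
  by rewrite -[p in LHS]comp_polyXr /comp_poly -horner_map /= gX gmap.
have := congr1 (fun P => (map_poly g P).[u]) hp; cbv beta.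
rewrite /poly_XaY map_comp_poly gmap gXY rmorphD /= gmap map_polyC /= gp.
by rewrite horner_comp !hornerE.
Qed.

Lemma additive_poly_comp p u v :
  p \in additive_poly -> p \Po (u + v) = (p \Po u) + (p \Po v).
Proof.
by move=> hp; rewrite /comp_poly; apply: (@additive_poly_horner {poly L} polyC).
Qed.

Fact additive_poly_zmod_closed : zmod_closed additive_poly.
Proof.
split=> [|p q /additive_polyP hp /additive_polyP hq]; apply/additive_polyP.
  by rewrite poly_XaY0 !rmorph0 addr0.
have -> : poly_XaY (p - q) = poly_XaY p - poly_XaY q.
  by rewrite /poly_XaY !rmorphB.
by rewrite hp hq !rmorphB /= opprD addrACA.
Qed.

HB.instance Definition _ :=
  GRing.isZmodClosed.Build {poly L} additive_poly additive_poly_zmod_closed.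

Fact additive_polyX : 'X \in additive_poly.
Proof. by apply/additive_polyP; rewrite /poly_XaY map_polyX comp_polyX. Qed.

Fact additive_polyZ c p : p \in additive_poly -> c *: p \in additive_poly.
Proof.
move=> /additive_polyP hp; apply/additive_polyP; rewrite /poly_XaY -!mul_polyC.
by rewrite !rmorphM /= map_polyC /= comp_polyC -/(poly_XaY p) hp mulrDr.
Qed.

Fact additive_polyXn n : [pchar L].-nat n -> 'X^n \in additive_poly.
Proof.
move=> hn; apply/additive_polyP; rewrite /poly_XaY map_polyXn comp_Xn_poly.
rewrite exprDn_pchar ?rmorphXn //.
by apply: sub_in_pnat hn => p _; rewrite !pchar_poly.
Qed.

Fact additive_poly_comp_closed p q :
  p \in additive_poly -> q \in additive_poly -> p \Po q \in additive_poly.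
Proof.
move=> hp hq; apply/additive_polyP; move/additive_polyP: hq => hq.
have mapE u : (map_poly (polyC \o polyC) p).[u] = p^:P \Po u.
  by rewrite map_poly_comp.
rewrite /poly_XaY map_comp_poly -comp_polyA -/(poly_XaY q) hq -!mapE.
rewrite additive_poly_horner // !mapE; congr (_ + _).
by rewrite /comp_poly horner_map.
Qed.

(* End_L(G_a); its product, defined below, is composition. *)
Record EndGa :=
  MkEndGa { Ga_poly :> {poly L}; Ga_polyP : Ga_poly \in additive_poly }.

HB.instance Definition _ := [isSub for Ga_poly].
HB.instance Definition _ := [Choice of EndGa by <:].
HB.instance Definition _ := [SubChoice_isSubZmodule of EndGa by <:].

Definition EndGa_one := MkEndGa additive_polyX.
Definition EndGa_mul (f g : EndGa) :=
  MkEndGa (additive_poly_comp_closed (Ga_polyP f) (Ga_polyP g)).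

Fact EndGa_mulA : associative EndGa_mul.
Proof. by move=> f g h; apply: val_inj; rewrite /= comp_polyA. Qed.

Fact EndGa_mul1g : left_id EndGa_one EndGa_mul.
Proof. by move=> f; apply: val_inj; rewrite /= comp_polyX. Qed.

Fact EndGa_mulg1 : right_id EndGa_one EndGa_mul.
Proof. by move=> f; apply: val_inj; rewrite /= comp_polyXr. Qed.

Fact EndGa_mulDl : left_distributive EndGa_mul +%R.
Proof. by move=> f g h; apply: val_inj; rewrite /= raddfD. Qed.

Fact EndGa_mulDr : right_distributive EndGa_mul +%R.
Proof.
by move=> f g h; apply: val_inj; rewrite /= additive_poly_comp ?Ga_polyP.
Qed.

Fact EndGa_1neq0 : EndGa_one != 0.
Proof. by rewrite -val_eqE /= polyX_eq0. Qed.

HB.instance Definition _ := GRing.Zmodule_isNzRing.Build EndGa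
  EndGa_mulA EndGa_mul1g EndGa_mulg1 EndGa_mulDl EndGa_mulDr EndGa_1neq0.

Definition EndGa_scal (c : L) : EndGa :=
  MkEndGa (additive_polyZ c additive_polyX).

Fact EndGa_scal_zmod : zmod_morphism EndGa_scal.
Proof. by move=> c d; apply: val_inj; rewrite /= scalerBl. Qed.

Fact EndGa_scal_monoid : monoid_morphism EndGa_scal.
Proof.
split=> [|c d]; apply: val_inj; rewrite /= ?scale1r //.
by rewrite comp_polyZ comp_polyX scalerA.
Qed.

HB.instance Definition _ :=
  GRing.isZmodMorphism.Build L EndGa EndGa_scal EndGa_scal_zmod.
HB.instance Definition _ :=
  GRing.isMonoidMorphism.Build L EndGa EndGa_scal EndGa_scal_monoid.

End AdditivePolynomials.

Section FieldOfConstants.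
Variables (F : finFieldType) (L : fieldType).
Variable gamma : {rmorphism {fraction {poly F}} -> L}.

Definition const_emb : F -> L := gamma \o @tofrac {poly F} \o polyC.
HB.instance Definition _ := GRing.RMorphism.on const_emb.

Definition t_emb : L := gamma (@tofrac {poly F} 'X).

Definition constants_alg_closed :=
  forall x : L, algebraicOver const_emb x -> exists c : F, const_emb c = x.

Definition lin_dependent2 (x y : L) :=
  exists c d : F, (c, d) != (0, 0) /\ const_emb c * x + const_emb d * y = 0.

Definition drinfeld_poly (r : nat) (a : nat -> L) : {poly L} :=
  t_emb *: 'X + \sum_(1 <= i < r) a i *: 'X^(#|F| ^ i) + 'X^(#|F| ^ r).

Record drinfeld_module (r : nat) := DrinfeldModule {
  drinfeld_hom :> {rmorphism {poly F} -> EndGa L};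
  drinfeld_const : forall c : F,
    Ga_poly (drinfeld_hom c%:P) = const_emb c *: 'X;
  drinfeld_t : exists a : nat -> L,
    Ga_poly (drinfeld_hom 'X) = drinfeld_poly r a
}.

(* Torsion points of Phi lying in L; all torsion points when L is algebraically
   closed. *)
Definition torsion r (Phi : drinfeld_module r) (x : L) :=
  exists2 a : {poly F}, a != 0 & (Ga_poly (Phi a)).[x] = 0.

Lemma pnat_cardX n : [pchar L].-nat (#|F| ^ n)%N.
Proof.
have [p p_pr pF] := finPcharP F.
have pL : p \in [pchar L] := rmorph_pchar const_emb pF.
rewrite pnatX; apply/orP; left.
rewrite (eq_pnat _ (pcharf_eq pL)) (card_pprimeChar pF) pnatX.
by rewrite pnat_id.
Qed.

Fact drinfeld_poly_additive r (a : nat -> L) :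
  drinfeld_poly r a \in @additive_poly L.
Proof.
rewrite /drinfeld_poly !rpredD ?additive_polyZ ?additive_polyX //.
  by apply: rpred_sum => i _; rewrite additive_polyZ ?additive_polyXn ?pnat_cardX.
by rewrite additive_polyXn ?pnat_cardX.
Qed.

Definition drinfeld_End r (a : nat -> L) : EndGa L :=
  MkEndGa (drinfeld_poly_additive r a).

Fact drinfeld_End_comm r (a : nat -> L) :
  commr_rmorph (@EndGa_scal L \o const_emb) (drinfeld_End r a).
Proof.
move=> c; apply: val_inj; rewrite /= comp_polyZ comp_polyX.
have cX i : const_emb c ^+ (#|F| ^ i) = const_emb c.
  rewrite -rmorphXn; congr (const_emb _).
  by elim: i => [|i IH]; rewrite ?expr1 // expnSr exprM IH expf_card.
have XcX i : 'X^(#|F| ^ i) \Po (const_emb c *: 'X)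
    = const_emb c *: 'X^(#|F| ^ i) by rewrite comp_Xn_poly exprZn cX.
rewrite /drinfeld_poly !(raddfD (comp_poly _)) raddf_sum /= !scalerDr.
rewrite comp_polyZ comp_polyX XcX !scalerA mulrC; congr (_ + _ + _).
rewrite scaler_sumr; apply: eq_bigr => i _.
by rewrite comp_polyZ XcX !scalerA mulrC.
Qed.

Fact drinfeld_hom_const r a (c : F) :
  Ga_poly (horner_morph (drinfeld_End_comm r a) c%:P) = const_emb c *: 'X.
Proof. by rewrite horner_morphC. Qed.

Fact drinfeld_hom_t r (a : nat -> L) : exists a' : nat -> L,
  Ga_poly (horner_morph (drinfeld_End_comm r a) 'X) = drinfeld_poly r a'.
Proof. by exists a; rewrite horner_morphX. Qed.

Definition drinfeld r (a : nat -> L) : drinfeld_module r :=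
  DrinfeldModule (drinfeld_hom_const r a) (drinfeld_hom_t r a).

Lemma drinfeldE r a : Ga_poly (drinfeld r a 'X) = drinfeld_poly r a.
Proof. by rewrite /= horner_morphX. Qed.

Lemma drinfeld_uniq r (Phi Psi : drinfeld_module r) :
  Ga_poly (Phi 'X) = Ga_poly (Psi 'X) -> Phi =1 Psi.
Proof.
move=> /val_inj eqX; elim/poly_ind => [|a c IH]; first by rewrite !rmorph0.
rewrite !rmorphD !rmorphM eqX IH /=; congr (_ + _).
by apply: val_inj; rewrite /= !drinfeld_const.
Qed.

End FieldOfConstants.

Section Family.
Variables (F : finFieldType) (K : fieldType) (Kbar : fieldType).
Variable gamma : {rmorphism {fraction {poly F}} -> K}.
Variable iota : {rmorphism K -> Kbar}.

(* The coefficients a_1 = z and a_i = 0 (1 < i < r), in K[z]. *)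
Definition family_coef (i : nat) : {poly K} := if i == 1%N then 'X else 0.

(* The generic member of the family lives over K(z); its members [Phi_spec]
   are obtained by evaluating the coefficients at z = lam. *)
Definition Phi (r : nat) :
    drinfeld_module (@tofrac {poly K} \o polyC \o gamma) r :=
  drinfeld _ r (fun i => @tofrac {poly K} (family_coef i)).

Definition Phi_spec (r : nat) (lam : Kbar) : drinfeld_module (iota \o gamma) r :=
  drinfeld _ r (fun i => (map_poly iota (family_coef i)).[lam]).

Lemma Phi_t r : (1 < r)%N ->
  Ga_poly (Phi r 'X) = t_emb (@tofrac {poly K} \o polyC \o gamma) *: 'X
    + @tofrac {poly K} 'X *: 'X^#|F| + 'X^(#|F| ^ r).
Proof.
move=> r_gt1; rewrite drinfeldE /drinfeld_poly; congr (_ + _ + _).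
rewrite big_ltn // big_nat big1 ?addr0 ?expn1 // => i /andP[i_gt1 _].
by rewrite /family_coef gtn_eqF // rmorph0 scale0r.
Qed.

Lemma Phi_spec_t r lam : (1 < r)%N ->
  Ga_poly (Phi_spec r lam 'X) = t_emb (iota \o gamma) *: 'X
    + lam *: 'X^#|F| + 'X^(#|F| ^ r).
Proof.
move=> r_gt1; rewrite drinfeldE /drinfeld_poly; congr (_ + _ + _).
rewrite big_ltn // big_nat big1 => [|i /andP[i_gt1 _]].
  by rewrite addr0 expn1 /= map_polyX hornerX.
by rewrite /family_coef gtn_eqF // rmorph0 horner0 scale0r.
Qed.

End Family.

(* Main.v *)
Require Import Defs.
From HB Require Import structures.
From mathcomp Require Import all_boot all_order all_algebra all_field.
From mathcomp Require Import boolp classical_sets cardinality.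
From mathcomp Require Import finmap zify ring.

Set Implicit Arguments.
Unset Strict Implicit.
Unset Printing Implicit Defensive.

Import GRing.Theory.
Local Open Scope classical_set_scope.
Local Open Scope ring_scope.

(** Why the theorem holds. Write q for the order of F, D = q ^ r, and let
    f_n(lam) be the value at a of the n-th iterate of the Drinfeld module of
    parameter lam at t. For n > 0 it is a polynomial in lam of degree
    D ^ (n - 1) with leading coefficient a ^ (q D ^ (n - 1)), so that at each
    place v the set of parameters for which the orbit of a is bounded has
    capacity |a|_v ^ (- q). A parameter for which a and b are both torsion lies,
    with all its conjugates, in the bounded sets of a and of b, and a set inside
    both has capacity at most max(|a|_v, |b|_v) ^ (- q). When a / b is not
    constant, the product of these numbers over all places is less than 1, and
    an argument of Fekete type leaves only finitely many such parameters.

    The argument is made elementary as follows. Let lam_1, ..., lam_N be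
    distinct parameters for which a and b are torsion, with N = D ^ m, and let V
    be their Vandermonde determinant. Products of the f_n form a basis of the
    polynomials of degree less than N, with one basis element of each degree j,
    of leading coefficient a ^ (q j). Hence a ^ M V, with M = q N (N - 1) / 2,
    is a determinant whose entries are products of values of the f_n at torsion
    parameters, and these values are integral up to a fixed denominator
    ([torsion_parameter_int], [orbit_int]). The determinant thus has a
    denominator s ^ E with E = O(N log N), negligible with respect to M
    ([torsion_vandermonde_int]). The same holds for b.

    If a and b are independent, u = a / b is not a constant of F, hence is
    transcendental over F. By exchange there is a field k over which u is
    transcendental and such that t, a and b are algebraic over k(u)
    ([transc_extend_seq]). The bound for b over k[u] gives s in k[u] with
    y = s ^ E b ^ M V integral over k[u]; the bound for a over k[1/u] gives
    (u ^ (- c) s) ^ E a ^ M V integral over k[1/u], and this element is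
    u ^ (M - c E) y because a = u b. Thus y has no poles and vanishes at
    infinity, so y = 0 ([liouville]), although b, s and V are nonzero.

    Conversely, when one of a and b is a constant multiple of the other, every
    parameter for which the latter is torsion serves both, and there are
    infinitely many of them ([torsion_infinite]). *)

(** * Integral closures and subfields of fractions *)

Section IntegralClosure.
Variables (R : comNzRingType) (L : fieldType) (f : {rmorphism R -> L}).

(** A boolean predicate, so that it can carry a canonical subring structure. *)
Definition int_closure : {pred L} := fun x => `[< integralOver f x >].

Lemma int_closureP x : reflect (integralOver f x) (x \in int_closure).
Proof. exact: asboolP. Qed.

Fact int_closure_subring : subring_closed int_closure.
Proof.
split; first exact/int_closureP/integral1.
  move=> x y /int_closureP hx /int_closureP hy.
  exact/int_closureP/integral_sub.
move=> x y /int_closureP hx /int_closureP hy.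
exact/int_closureP/integral_mul.
Qed.
HB.instance Definition _ :=
  GRing.isSubringClosed.Build L int_closure int_closure_subring.

Lemma int_closure_id x : f x \in int_closure.
Proof. exact/int_closureP/integral_id. Qed.

Definition int_closed (S : {pred L}) :=
  forall p x, p \is monic -> p \is a polyOver S -> root p x -> x \in S.

Lemma int_closure_closed : int_closed int_closure.
Proof.
move=> p x mp /polyOverP hp rx; apply/int_closureP.
apply: integral_root_monic mp rx _; apply/integral_poly => i.
exact/int_closureP.
Qed.

(** Replacing a root x of p by h x multiplies the coefficient of degree i by
    h ^ (deg p - i); it therefore suffices that h cancels the denominators of
    the lower coefficients, each weighted by its codegree. *)
Lemma int_closed_scale (S : subringClosed L) (h : L) (p : {poly L}) (x : L) :
  int_closed S -> p \is monic -> root p x ->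
  (forall i, (i < (size p).-1)%N -> h ^+ ((size p).-1 - i) * p`_i \in S) ->
  h * x \in S.
Proof.
move=> Scl mp rx hS; set n := (size p).-1 in hS.
have sp : size p = n.+1 by rewrite prednK // size_poly_gt0 monic_neq0.
have pn : p`_n = 1 by rewrite -(monicP mp).
pose q := \poly_(i < n.+1) (h ^+ (n - i) * p`_i).
have qn : q`_n = 1 by rewrite coef_poly leqnn subnn mul1r.
have sq : size q = n.+1.
  by apply: size_poly_eq; rewrite subnn mul1r pn oner_eq0.
apply: (Scl q); first by rewrite monicE lead_coefE sq qn.
- apply/polyOverP => i; case: (ltngtP i n) => [lt_in|lt_ni|->].
  - by rewrite coef_poly ltnS ltnW // hS.
  - by rewrite nth_default ?sq ?rpred0.
  - by rewrite qn rpred1.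
have : h ^+ n * p.[x] = 0 by rewrite (rootP rx) mulr0.
rewrite /root horner_poly horner_coef sp mulr_sumr => sum0.
apply/eqP; rewrite -[RHS]sum0; apply: eq_bigr => i _.
by rewrite exprMn mulrACA -exprD subnK // -ltnS.
Qed.

(** Algebraicity over the image of a ring: for R = k[u] this means algebraic
    over the field k(u), without forming that field. *)
Definition algOver (x : L) :=
  exists2 P : {poly R}, map_poly f P != 0 & root (map_poly f P) x.

(** The leading coefficient of an annihilating polynomial is a common
    denominator. *)
Lemma algOver_mult x :
  algOver x -> exists2 s, f s != 0 & f s * x \in int_closure.
Proof.
case=> P P0 rx; set p := map_poly f P in P0 rx; pose c := lead_coef p.
have c0 : c != 0 by rewrite lead_coef_eq0.
have cE : f P`_(size p).-1 = c by rewrite /c lead_coefE coef_map.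
exists P`_(size p).-1; rewrite cE //.
have sz : size (c^-1 *: p) = size p by rewrite size_scale ?invr_eq0.
apply: (int_closed_scale int_closure_closed (p := c^-1 *: p)).
- by rewrite monicE lead_coefZ mulVf.
- by rewrite rootZ ?invr_eq0.
move=> i; rewrite sz -subn_gt0 coefZ => /prednK <-.
rewrite exprS mulrAC mulrA mulfV // mul1r coef_map -cE.
by rewrite rpredM ?rpredX ?int_closure_id.
Qed.

End IntegralClosure.

Section FracField.
Variables (R : comNzRingType) (L : fieldType) (f : {rmorphism R -> L}).

(** The subfield of L generated by the image of R. *)
Definition fracs : {pred L} :=
  fun x => `[< exists p q, f q != 0 /\ x = f p / f q >].

Fact fracs_divring : divring_closed fracs.
Proof.
split.
- by apply/asboolP; exists 1, 1; rewrite rmorph1 oner_eq0 divr1.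
- move=> _ _ /asboolP[p [q [q0 ->]]] /asboolP[p' [q' [q0' ->]]]; apply/asboolP.
  exists (p * q' - p' * q), (q * q').
  split; first by rewrite rmorphM mulf_neq0.
  by rewrite -mulNr addf_div // rmorphB !rmorphM mulNr.
- move=> _ _ /asboolP[p [q [q0 ->]]] /asboolP[p' [q' [q0' ->]]]; apply/asboolP.
  have [->|p0'] := eqVneq (f p') 0.
    by exists 0, 1; rewrite rmorph1 oner_eq0 rmorph0 mul0r invr0 mulr0 mul0r.
  exists (p * q'), (q * p'); split; first by rewrite rmorphM mulf_neq0.
  by rewrite invf_div mulf_div !rmorphM.
Qed.
HB.instance Definition _ := GRing.isDivringClosed.Build L fracs fracs_divring.

Record fracField := FracField { frac_val : L; frac_valP : frac_val \in fracs }.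
HB.instance Definition _ := [isSub for frac_val].
HB.instance Definition _ := [Choice of fracField by <:].
HB.instance Definition _ := [SubChoice_isSubIntegralDomain of fracField by <:].
HB.instance Definition _ := [SubIntegralDomain_isSubField of fracField by <:].
HB.instance Definition _ :=
  GRing.isZmodMorphism.Build fracField L frac_val (fun x y => erefl).
HB.instance Definition _ :=
  GRing.isMonoidMorphism.Build fracField L frac_val (erefl, fun x y => erefl).


End FracField.

(** * Transcendental elements and exchange *)

(** Clear the denominators of an annihilating polynomial. *)
Lemma algebraic_frac (R : comNzRingType) (L : fieldType)
    (f : {rmorphism R -> L}) (x : L) :
  algebraicOver (@frac_val R L f) x -> algOver f x.
Proof.
case=> P P0 rx.
have [s [Q [s0 QE]]] : exists s Q, f s != 0 /\
    map_poly f Q = f s *: map_poly (@frac_val R L f) P.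
  elim/poly_ind: P {P0 rx} => [|P c [s [Q [s0 IH]]]].
    by exists 1, 0; split; rewrite ?rmorph1 ?oner_neq0 ?map_poly0 ?scaler0.
  have /asboolP[p [d [d0 cE]]] := frac_valP c.
  exists (s * d), (d *: Q * 'X + (s * p)%:P); split.
    by rewrite rmorphM mulf_neq0.
  rewrite !rmorphD !rmorphM /= !map_polyX !map_polyC /= map_polyZ /= IH cE.
  rewrite scalerDr scalerA [f d * f s]mulrC scalerAl.
  congr (_ + _); rewrite -mul_polyC -!polyCM; congr (_%:P).
  by rewrite -mulrA [f d * _]mulrC divfK.
exists Q; rewrite QE ?rootZ //.
by rewrite scaler_eq0 negb_or s0 map_poly_eq0.
Qed.

Section Eval.
Variables (k L : fieldType) (j : {rmorphism k -> L}).

Definition ev (u : L) : {poly k} -> L := horner_eval u \o map_poly j.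
HB.instance Definition _ u := GRing.RMorphism.on (ev u).

Lemma evE u p : ev u p = (map_poly j p).[u]. Proof. by []. Qed.

Lemma evX u : ev u 'X = u.
Proof. by rewrite evE map_polyX hornerX. Qed.

Definition transc (u : L) := ~ algebraicOver j u.

Lemma transc_ev0 u p : transc u -> ev u p = 0 -> p = 0.
Proof.
move=> tu up; apply/eqP/negP => p0; apply: tu; exists p; first exact/negP.
exact/eqP.
Qed.

Lemma transc_ev_neq0 u p : transc u -> p != 0 -> ev u p != 0.
Proof. by move=> tu; apply: contra_neq => /(transc_ev0 tu). Qed.

Lemma ev_inj u : transc u -> injective (ev u).
Proof.
move=> tu p q /eqP; rewrite -subr_eq0 -rmorphB => /eqP /(transc_ev0 tu).
by move/eqP; rewrite subr_eq0 => /eqP.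
Qed.

Lemma transc_neq0 u : transc u -> u != 0.
Proof.
move=> tu; rewrite -[u]evX; apply: transc_ev_neq0 tu _.
by rewrite polyX_eq0.
Qed.

Lemma transcV u : transc u -> transc u^-1.
Proof. by move=> tu /algebraic_inv; rewrite invrK. Qed.
End Eval.

Section Exchange.
Variables (k L : fieldType) (j : {rmorphism k -> L}).

(** A relation between u and w over k, read as a polynomial in u with
    coefficients in k[w], is also one in w with coefficients in k[u]; it stays
    nonzero there because u is transcendental. This is the exchange property. *)
Lemma swap_algOver (w u : L) :
  transc j u -> algOver (ev j w) u -> algOver (ev j u) w.
Proof.
move=> tu [Q Q0 ru]; exists (swapXY Q).
  have : swapXY Q != 0.
    apply: contra_neq Q0 => /eqP.
    by rewrite swapXY_eq0 => /eqP->; rewrite rmorph0.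
  apply: contra_neq => /polyP Qu0; apply/polyP => i; rewrite coef0.
  by apply: (transc_ev0 tu); have := Qu0 i; rewrite coef_map coef0.
have mapE x y (P : {poly {poly k}}) :
    (map_poly (ev j x) P).[y] = (map_poly (map_poly j) P).[y, x].
  rewrite -horner2_swapXY horner_swapXY -map_poly_comp.
  by congr (_.[_]); apply: eq_map_poly.
by rewrite /root mapE -swapXY_map horner2_swapXY -mapE.
Qed.

(** If w is not already algebraic over k(u), then adjoin w to k: by exchange u
    remains transcendental over k(w). *)
Lemma transc_extend (u w : L) : transc j u ->
  exists (k' : fieldType) (g : {rmorphism k -> k'}) (j' : {rmorphism k' -> L}),
  [/\ j =1 j' \o g, transc j' u & algOver (ev j' u) w].
Proof.
move=> tu; case: (pselect (algOver (ev j u) w)) => [hw|nw].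
  by exists k, idfun, j.
have jw_frac c : j c \in fracs (ev j w).
  apply/asboolP; exists c%:P, 1; rewrite rmorph1 oner_neq0 divr1.
  by split; rewrite //= evE map_polyC hornerC.
pose g c : fracField (ev j w) := FracField (jw_frac c).
have g_zmod : zmod_morphism g by move=> c d; apply: val_inj; rewrite /= rmorphB.
have g_monoid : monoid_morphism g.
  by split=> [|c d]; apply: val_inj; rewrite /= ?rmorph1 ?rmorphM.
pose gZ := GRing.isZmodMorphism.Build _ _ g g_zmod.
pose gM := GRing.isMonoidMorphism.Build _ _ g g_monoid.
pose g' : {rmorphism k -> fracField (ev j w)} := HB.pack g gZ gM.
exists (fracField (ev j w)), g', (@frac_val _ _ (ev j w)); split=> //.
  by move/algebraic_frac/(swap_algOver tu).
have wf : w \in fracs (ev j w).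
  by apply/asboolP; exists 'X, 1; rewrite rmorph1 oner_neq0 divr1 /= evX.
exists ('X - (FracField wf)%:P%:P).
  rewrite rmorphB /= map_polyX map_polyC /= polyXsubC_eq0 //.
by rewrite rmorphB /= map_polyX map_polyC /= evE map_polyC hornerC root_XsubC.
Qed.

Lemma algOver_extend (k' : fieldType) (g : {rmorphism k -> k'})
    (j' : {rmorphism k' -> L}) (u w : L) :
  j =1 j' \o g -> algOver (ev j u) w -> algOver (ev j' u) w.
Proof.
move=> jE [P P0 rw]; exists (map_poly (map_poly g) P); rewrite -map_poly_comp;
  rewrite (_ : map_poly _ P = map_poly (ev j u) P) //; apply: eq_map_poly => p;
  rewrite /= !evE -map_poly_comp; congr (_.[_]); exact: eq_map_poly.
Qed.
End Exchange.

Lemma transc_extend_seq (k L : fieldType) (j : {rmorphism k -> L}) (u : L)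
    (ws : seq L) : transc j u ->
  exists (k' : fieldType) (j' : {rmorphism k' -> L}),
  [/\ exists g : {rmorphism k -> k'}, j =1 j' \o g,
      transc j' u & forall w, w \in ws -> algOver (ev j' u) w].
Proof.
elim: ws => [|w ws IH] in k j * => tu.
  by exists k, j; split => //; exists idfun.
have [k1 [g1 [j1 [jE1 tu1 w1]]]] := transc_extend w tu.
have [k2 [j2 [[g2 jE2] tu2 ws2]]] := IH _ _ tu1.
exists k2, j2; split=> //.
  by exists (g2 \o g1) => c /=; rewrite jE1 /= jE2.
move=> x; rewrite inE => /predU1P[->|]; last exact: ws2.
exact: algOver_extend jE2 w1.
Qed.

(** * Integrality over k[u] and over k[1/u] *)

(** The list rs is the list of conjugates of y over E, the roots of its minimal
    polynomial. That polynomial is obtained as a monic annihilator of least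
    degree, which is what makes it divide every other annihilator. *)
Lemma conjugates (E : fieldType) (L : closedFieldType) (v : {rmorphism E -> L})
    (y : L) : algebraicOver v y ->
  exists rs : seq L,
  [/\ y \in rs, exists e, v e = \prod_(z <- rs) z, 0 \in rs -> y = 0
    & forall P : {poly E}, root (map_poly v P) y ->
        {in rs, forall z, root (map_poly v P) z}].
Proof.
move=> /integral_algebraic [P0 mP0 rP0].
pose D n := `[< exists m : {poly E},
  [/\ m \is monic, root (map_poly v m) y & size m = n] >].
have exD : exists n, D n by exists (size P0); apply/asboolP; exists P0.
have [n /asboolP[m [mm rm sm]] min_n] := ex_minnP exD.
have min P : P != 0 -> root (map_poly v P) y -> (size m <= size P)%N.
  move=> PN0 rP; rewrite sm; apply: min_n; apply/asboolP.
  have lc0 : (lead_coef P)^-1 != 0 by rewrite invr_eq0 lead_coef_eq0.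
  exists ((lead_coef P)^-1 *: P); split; last by rewrite size_scale.
    by rewrite monicE lead_coefZ mulVf // lead_coef_eq0.
  by rewrite map_polyZ rootZ ?fmorph_eq0.
have dvd P : root (map_poly v P) y -> m %| P.
  move=> rP; rewrite /dvdp; apply: contraT => mod0.
  suff /(min _ mod0) : root (map_poly v (P %% m)) y.
    by rewrite leqNgt ltn_modpN0 ?monic_neq0.
  move: rP; rewrite {1}(divp_eq P m) /root rmorphD rmorphM /= hornerD hornerM.
  by rewrite (rootP rm) mulr0 add0r.
have [rs mE] := closed_field_poly_normal (map_poly v m).
have mv : map_poly v m \is monic by rewrite map_monic.
move: mE; rewrite (monicP mv) scale1r => mE.
have rsE z : (z \in rs) = root (map_poly v m) z by rewrite mE root_prod_XsubC.
exists rs; split.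
- by rewrite rsE.
- exists ((-1) ^+ size rs * m`_0).
  rewrite rmorphM rmorphXn rmorphN1 -coef_map mE coef0_prod_XsubC mulrA.
  by rewrite -exprMn mulrNN mulr1 expr1n mul1r.
- rewrite rsE -[X in root _ X](rmorph0 v) -[root _ _]/(_ == 0).
  rewrite horner_map fmorph_eq0.
  rewrite -[_ == 0]/(root m 0) => /factor_theorem [h hE].
  apply/eqP; apply: contraT => y0.
  have h0 : h != 0.
    by apply: contra_neq (monic_neq0 mm) => h0; rewrite hE h0 mul0r.
  have : (size m <= size h)%N.
    apply: min => //; move: rm; rewrite hE rmorphM /= rootM => /orP[] //.
    by rewrite subr0 map_polyX rootX (negPf y0).
  by rewrite hE size_Mmonic ?monicXsubC // size_XsubC addn2 /= ltnn.
move=> P /dvd /dvdpP [Q ->] z; rewrite rsE => rz.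
by rewrite rmorphM rootM rz orbT.
Qed.

Section RationalFunctions.
Variables (k L : fieldType) (j : {rmorphism k -> L}).

(** k[u] is integrally closed, by the rational root argument: in lowest terms
    p / q, the denominator q divides a power of p. *)
Lemma ev_integrally_closed (u : L) (p q : {poly k}) : transc j u -> q != 0 ->
  ev j u p / ev j u q \in int_closure (ev j u) ->
  exists r, ev j u p / ev j u q = ev j u r.
Proof.
move=> tu q0 /int_closureP [P mP rP].
have gq : gcdp p q %| q by apply: dvdp_gcdr.
have gp : gcdp p q %| p by apply: dvdp_gcdl.
have cpq : coprimep (p %/ gcdp p q) (q %/ gcdp p q).
  by rewrite coprimep_div_gcd ?q0 ?orbT.
set p' := p %/ gcdp p q in cpq; set q' := q %/ gcdp p q in cpq.
have g0 : ev j u (gcdp p q) != 0.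
  by rewrite transc_ev_neq0 // gcdp_eq0 negb_and q0 orbT.
have q'0 : ev j u q' != 0.
  rewrite transc_ev_neq0 //; apply: contra_neq q0 => q'0.
  by rewrite -(divpK gq) -/q' q'0 mul0r.
have xE : ev j u p / ev j u q = ev j u p' / ev j u q'.
  have pE : ev j u p = ev j u p' * ev j u (gcdp p q) by rewrite -rmorphM divpK.
  have qE : ev j u q = ev j u q' * ev j u (gcdp p q) by rewrite -rmorphM divpK.
  by rewrite pE qE -mulf_div divff // mulr1.
rewrite xE in rP *; set n := (size P).-1.
have sP : size P = n.+1 by rewrite prednK // size_poly_gt0 monic_neq0.
have Pn : P`_n = 1 by rewrite /n -lead_coefE (monicP mP).
have q'_dvd : q' %| p' ^+ n.
  have [h hE] : exists h, p' ^+ n = h * q'.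
    exists (- \sum_(i < n) P`_i * (p' ^+ i * q' ^+ (n - i.+1))).
    apply: (ev_inj tu); apply/eqP; rewrite -subr_eq0 -rmorphB.
    rewrite mulNr opprK mulr_suml rmorphD rmorph_sum /=.
    have : ev j u q' ^+ n * (map_poly (ev j u) P).[ev j u p' / ev j u q'] = 0.
      by rewrite (rootP rP) mulr0.
    rewrite horner_coef size_map_poly_id0; last first.
      by rewrite (monicP mP) rmorph1 oner_eq0.
    rewrite sP big_ord_recr /= mulrDr mulr_sumr coef_map /= Pn rmorph1 mul1r.
    rewrite exprMn mulrCA exprVn divff ?expf_neq0 // mulr1 rmorphXn addrC.
    move=> sum0; apply/eqP; rewrite -[RHS]sum0; congr (_ + _).
    apply: eq_bigr => i _; rewrite !rmorphM !rmorphXn coef_map /=.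
    have -> : ev j u q' ^+ n
        = ev j u q' ^+ (n - i.+1) * ev j u q' * ev j u q' ^+ i.
      by rewrite -exprSr -exprD -subSn // subSS subnK // ltnW.
    rewrite expr_div_n; move: (expf_neq0 i q'0).
    move: (ev j u q' ^+ i) => z z0; by field.
  rewrite hE; exact: dvdp_mull.
have : q' %| p' ^+ n * 1 by rewrite mulr1.
rewrite Gauss_dvdpr; last by rewrite coprimep_sym coprimep_expl.
rewrite dvdp1 => /size_poly1P [c c0 q'E].
exists (c^-1 *: p'); rewrite q'E -mul_polyC rmorphM mulrC /=.
rewrite !evE !map_polyC !hornerC; congr (_ * _); exact: (esym (fmorphV j c)).
Qed.

(** The polynomial in 1 / u has the coefficients of p in reverse order. *)
Lemma ev_inv (u : L) (p : {poly k}) n : u != 0 -> (size p <= n.+1)%N ->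
  exists2 q : {poly k}, (size q <= n.+1)%N & ev j u p * u^-1 ^+ n = ev j u^-1 q.
Proof.
move=> u0 sp; exists (\poly_(i < n.+1) p`_(n - i)); first exact: size_poly.
rewrite !evE (horner_coef_wide _ (n := n.+1)); last first.
  by rewrite (leq_trans (size_poly _ _)).
rewrite [RHS](horner_coef_wide _ (n := n.+1)); last first.
  by rewrite (leq_trans (size_poly _ _)) // size_poly.
rewrite mulr_suml [RHS](reindex_inj rev_ord_inj) /=; apply: eq_bigr => i _.
have le_in : (i <= n)%N by rewrite -ltnS.
rewrite !coef_map coef_poly /= !subSS ltnS leq_subr subKn //.
rewrite -mulrA; congr (_ * _); rewrite -[X in _ * u^-1 ^+ X](subnKC le_in).
rewrite exprD mulrA -exprMn.
by rewrite mulfV // expr1n mul1r.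
Qed.

(** The elements integral over k[u] have poles of bounded order at infinity:
    d only has to exceed the degrees of the coefficients of an integral
    equation. *)
Lemma int_closure_pole_at_infinity (u x : L) :
  u != 0 -> x \in int_closure (ev j u) ->
  exists c, forall d, (c <= d)%N -> u^-1 ^+ d * x \in int_closure (ev j u^-1).
Proof.
move=> u0 /int_closureP[P mP rP].
exists (\max_(i < size P) size (P`_i)%R) => d le_cd.
have mP' : map_poly (ev j u) P \is monic by exact: monic_map.
have sP' : size (map_poly (ev j u) P) = size P.
  by rewrite size_map_poly_id0 // (monicP mP) rmorph1 oner_eq0.
apply: (int_closed_scale (@int_closure_closed _ _ (ev j u^-1)) mP' rP) => i.
rewrite sP' => lt_i; rewrite coef_map /= -exprM mulrC.
have lt_iP : (i < size P)%N by apply: leq_trans lt_i (leq_pred _).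
have [|q _ ->] := @ev_inv u P`_i (d * ((size P).-1 - i)) u0.
  apply: leq_trans (leqW (leq_pmulr _ _)); last by rewrite subn_gt0.
  apply: leq_trans le_cd; exact: (leq_bigmax (Ordinal lt_iP)).
exact: int_closure_id.
Qed.

(** For algebraic elements, s clears the finite poles and u ^ (- c) then the
    poles at infinity that they and s have. *)
Lemma common_mult (u : L) (xs : seq L) : transc j u ->
  {in xs, forall x, algOver (ev j u) x} ->
  exists (s : {poly k}) c, [/\ s != 0 & {in xs, forall x,
    ev j u s * x \in int_closure (ev j u) /\
    u^-1 ^+ c * ev j u s * x \in int_closure (ev j u^-1)}].
Proof.
move=> tu; have u0 := transc_neq0 tu.
elim: xs => [|x xs IH] hx.
  by exists 1, 0; rewrite oner_neq0.
have [|s [c [s0 hs]]] := IH.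
  by move=> y yx; apply: hx; rewrite inE yx orbT.
have [s1 s10 s1x] := algOver_mult (hx x (mem_head _ _)).
pose t := s1 * s.
have tint y : y \in x :: xs -> ev j u t * y \in int_closure (ev j u).
  rewrite inE => /predU1P[->|yx]; rewrite rmorphM /=.
    by rewrite mulrAC mulrC rpredM ?int_closure_id.
  by rewrite -mulrA rpredM ?int_closure_id //; have [] := hs y yx.
have [c' hc'] : exists c', forall y, y \in x :: xs ->
    forall d, (c' <= d)%N ->
    u^-1 ^+ d * (ev j u t * y) \in int_closure (ev j u^-1).
  elim: (x :: xs) tint => [|y ys IHy] tint; first by exists 0.
  have [|c1 hc1] := IHy; first by move=> z zy; apply: tint; rewrite inE zy orbT.
  have [c2 hc2] := int_closure_pole_at_infinity u0 (tint y (mem_head _ _)).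
  exists (maxn c1 c2) => z; rewrite inE => zys d.
  rewrite geq_max => /andP[h1 h2].
  by case/predU1P: zys => [->|zy]; [exact: hc2 | exact: hc1].
exists t, c'; split.
  by rewrite mulf_neq0 //; apply: contra_neq s10 => ->; rewrite rmorph0.
by move=> y yx; split; [exact: tint | rewrite -mulrA; apply: hc'].
Qed.
End RationalFunctions.

Lemma frac_lift (R : comNzRingType) (L : fieldType) (f : {rmorphism R -> L})
    (p : {poly L}) : p \is a polyOver (fracs f) ->
  exists P : {poly fracField f}, map_poly (@frac_val _ _ f) P = p.
Proof.
move=> /polyOverP hp; exists (\poly_(i < size p) (FracField (hp i))).
apply/polyP => i; rewrite coef_map coef_poly.
by case: ltnP => // /leq_sizeP/(_ i) ->.
Qed.

Section Liouville.
Variables (k : fieldType) (L : closedFieldType) (j : {rmorphism k -> L}).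
Variable u : L.
Hypothesis tu : transc j u.

Lemma fracs_const c : j c \in fracs (ev j u).
Proof.
apply/asboolP; exists c%:P, 1; rewrite rmorph1 oner_neq0 divr1; split=> //=.
by rewrite evE map_polyC hornerC.
Qed.

Lemma fracs_gen : u \in fracs (ev j u).
Proof.
by apply/asboolP; exists 'X, 1; rewrite rmorph1 oner_neq0 divr1 /= evX.
Qed.

Lemma fracs_ev v p : v \in fracs (ev j u) -> ev j v p \in fracs (ev j u).
Proof.
move=> vf; rewrite evE horner_coef; apply: rpred_sum => i _.
by rewrite coef_map rpredM ?rpredX //; apply: fracs_const.
Qed.

(** As k[1/u] is integrally closed, such a polynomial in u is also a polynomial
    in 1 / u; clear the denominator and compare degrees. *)
Lemma polynomial_without_pole_const (g : {poly k}) :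
  ev j u g \in int_closure (ev j u^-1) -> (size g <= 1)%N.
Proof.
move=> gint; have u0 := transc_neq0 tu; have tv := transcV tu.
have [g' sg' g'E] := ev_inv j u0 (leqnSn (size g)).
have [||r rE] := ev_integrally_closed (p := g') (q := 'X^(size g)) tv.
- by rewrite -size_poly_eq0 size_polyXn.
- rewrite -g'E rmorphXn /= evX mulfK //.
  by rewrite expf_neq0 // invr_eq0.
move: rE; rewrite -g'E rmorphXn /= evX mulfK ?expf_neq0 ?invr_eq0 // => gE.
have vK : u^-1^-1 = u by rewrite invrK.
have v0 : u^-1 != 0 by rewrite invr_eq0.
have [r' sr' r'E] := ev_inv j v0 (leqnSn (size r)).
rewrite -gE vK in r'E.
have {}r'E : g * 'X^(size r) = r'.
  by apply: (ev_inj tu); rewrite rmorphM rmorphXn /= evX.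
have [->|g0] := eqVneq g 0; first by rewrite size_poly0.
move: sr'; rewrite -r'E size_Mmonic ?monicXn // size_polyXn addnS /=.
by rewrite -addn1 addnC leq_add2l.
Qed.

(** A function without poles that vanishes at infinity is zero. The product of
    the conjugates of y inherits both properties and lies in k(u), hence in
    k[u], where they force it to vanish; then some conjugate of y is 0, and so
    is y. *)
Lemma liouville y n : y \in int_closure (ev j u) ->
  u ^+ n.+1 * y \in int_closure (ev j u^-1) -> y = 0.
Proof.
move=> /int_closureP[P mP rP] /int_closureP[Q mQ rQ].
have u0 := transc_neq0 tu.
have uf := fracs_gen.
pose p := map_poly (ev j u) P.
(* The equation over k[1/u] for u ^ (n + 1) y, rewritten as one for y. *)
pose q := map_poly (ev j u^-1) Q \Po (u ^+ n.+1 *: 'X).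
have pf : p \is a polyOver (fracs (ev j u)).
  by apply/polyOverP => i; rewrite coef_map; apply: fracs_ev.
have qf : q \is a polyOver (fracs (ev j u)).
  rewrite /q polyOver_comp //.
    by apply/polyOverP => i; rewrite coef_map; apply: fracs_ev; rewrite rpredV.
  by rewrite polyOverZ ?rpredX // polyOverX.
have [P1 P1E] := frac_lift pf; have [Q1 Q1E] := frac_lift qf.
have qE z : q.[z] = (map_poly (ev j u^-1) Q).[u ^+ n.+1 * z].
  by rewrite horner_comp hornerZ hornerX.
have [|rs [yrs [e eE] rs0 conj]] := @conjugates _ _ (@frac_val _ _ (ev j u)) y.
  exists P1; last by rewrite P1E.
  rewrite -(map_poly_eq0 (@frac_val _ _ (ev j u))) P1E.
  by rewrite monic_neq0 // monic_map.
have Oz z : z \in rs -> z \in int_closure (ev j u).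
  move=> zrs; apply/int_closureP; exists P => //; rewrite -/p -P1E.
  by apply: conj zrs; rewrite P1E.
have O'z z : z \in rs -> u ^+ n.+1 * z \in int_closure (ev j u^-1).
  move=> zrs; apply/int_closureP; exists Q => //.
  have : root (map_poly (@frac_val _ _ (ev j u)) Q1) z.
    by apply: conj zrs; rewrite Q1E /root qE.
  by rewrite Q1E /root qE.
have nuO : \prod_(z <- rs) z \in int_closure (ev j u).
  by rewrite big_seq rpred_prod.
have nuO' :
    u ^+ (n.+1 * size rs) * \prod_(z <- rs) z \in int_closure (ev j u^-1).
  suff -> : u ^+ (n.+1 * size rs) * \prod_(z <- rs) z
      = \prod_(z <- rs) (u ^+ n.+1 * z) by rewrite big_seq rpred_prod.
  by rewrite big_split big_const_seq count_predT iter_mulr_1 exprM.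
have [a [b [b0 abE]]] := asboolP _ (frac_valP e).
have b0' : b != 0 by apply: contra_neq b0 => ->; rewrite rmorph0.
have [r rE] : exists r, ev j u a / ev j u b = ev j u r.
  by apply: ev_integrally_closed => //; rewrite -[_ / _]abE eE.
have nuE : \prod_(z <- rs) z = ev j u r by rewrite -eE -rE -abE.
apply/eqP; apply: contraT => y0.
have r0 : r != 0.
  have : \prod_(z <- rs) z != 0.
    rewrite prodf_seq_neq0; apply/allP => z zrs /=.
    by apply: contraNneq y0 => z0; apply/eqP/rs0; rewrite -z0.
  by rewrite nuE; apply: contra_neq => ->; rewrite rmorph0.
have srs : (0 < size rs)%N by case: (rs) yrs.
have := @polynomial_without_pole_const ('X^(n.+1 * size rs) * r).
rewrite rmorphM rmorphXn /= evX -nuE => /(_ nuO').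
rewrite mulrC size_Mmonic ?monicXn // size_polyXn addnS /=.
have : (0 < size r)%N by rewrite size_poly_gt0.
case: (size r) => // m _.
by rewrite addSn ltnS leqn0 addn_eq0 muln_eq0 /= (gtn_eqF srs) andbF.
Qed.
End Liouville.

(** * A degree-raising recursion on polynomials *)

Section Twist.
Variables (L : fieldType) (q D : nat).
Hypotheses (q_gt1 : (1 < q)%N) (q2_le_D : (2 * q <= D)%N).

(** Since D exceeds q by at least 2, the term of exponent D dominates even when
    A has degree 1. *)
Lemma size_lead_step (p A : {poly L}) (B : L) d :
  size p = d.+2 -> (size A <= 2)%N ->
  let p' := p ^+ D + (A * p ^+ q + B *: p) in
  size p' = (d.+1 * D).+1 /\ lead_coef p' = lead_coef p ^+ D.
Proof.
move=> sp sA p'.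
have sX n : size (p ^+ n) = (d.+1 * n).+1.
  have p0 : p ^+ n != 0 by rewrite expf_neq0 // -size_poly_gt0 sp.
  by rewrite -[LHS]prednK ?size_poly_gt0 // size_exp sp.
have lt : (size (A * p ^+ q + B *: p)%R < size (p ^+ D)%R)%N.
  rewrite sX ltnS (leq_trans (size_polyD _ _)) // geq_max; apply/andP; split.
    rewrite (leq_trans (size_polyMleq _ _)) // sX.
    by move: (size A) sA => [|[|[|]]] //= _; nia.
  by rewrite (leq_trans (size_scale_leq _ _)) // sp; nia.
by rewrite /p' size_polyDl // lead_coefDl // sX lead_coef_exp.
Qed.

(** The common shape of the iterates of a Drinfeld module, seen as polynomials
    either in the point or in the parameter, after a change of scale. *)
Fixpoint twist (A : nat -> {poly L}) (B : nat -> L) p n :=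
  if n is n'.+1 then
    twist A B p n' ^+ D + (A n' * twist A B p n' ^+ q + B n' *: twist A B p n')
  else p.

Variables (O : subringClosed L) (A : nat -> {poly L}) (B : nat -> L).
Variable p : {poly L}.
Hypotheses (sA : forall n, (size (A n) <= 2)%N) (sp : size p = 2).
Hypotheses (mp : p \is monic) (pO : p \is a polyOver O).
Hypotheses (AO : forall n, A n \is a polyOver O) (BO : forall n, B n \in O).

Let D_gt0 : (0 < D)%N. Proof. lia. Qed.

Lemma twist_size n : size (twist A B p n) = (D ^ n).+1.
Proof.
elim: n => //= n IH.
have Dn : (0 < D ^ n)%N by rewrite expn_gt0 D_gt0.
have sz : size (twist A B p n) = (D ^ n).-1.+2 by rewrite prednK.
by have [-> _] := size_lead_step (B n) sz (sA n); rewrite prednK // expnSr.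
Qed.

Lemma twist_monic n : twist A B p n \is monic.
Proof.
elim: n => //= n IH.
have Dn : (0 < D ^ n)%N by rewrite expn_gt0 D_gt0.
have sz : size (twist A B p n) = (D ^ n).-1.+2 by rewrite prednK // twist_size.
have [_ lE] := size_lead_step (B n) sz (sA n).
by rewrite monicE lE (monicP IH) expr1n.
Qed.

Lemma twist_over n : twist A B p n \is a polyOver O.
Proof.
by elim: n => //= n IH; rewrite !rpredD ?polyOverZ ?rpredX ?rpredM ?rpredX.
Qed.

(** Divided by c, the relation says that z is a root of a monic polynomial of
    degree D ^ d over O, as all other terms have lower degree. *)
Lemma twist_root (c m0 : L) (m : nat -> L) d z : int_closed O ->
  c^-1 \in O -> c != 0 -> m0 \in O -> (forall i, (i < d)%N -> m i \in O) ->
  m0 + \sum_(i < d) m i * (twist A B p i).[z] + c * (twist A B p d).[z] = 0 ->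
  z \in O.
Proof.
move=> Ocl cVO c0 m0O mO sum0.
pose h := c^-1 *: (m0%:P + \sum_(i < d) m i *: twist A B p i).
have sh : (size h < size (twist A B p d))%N.
  rewrite (leq_ltn_trans (size_scale_leq _ _)) // twist_size ltnS.
  rewrite (leq_trans (size_polyD _ _)) // geq_max; apply/andP; split.
    by rewrite (leq_trans (size_polyC_leq1 _)) // expn_gt0 D_gt0.
  rewrite (leq_trans (size_sum _ _ _)) //; apply/bigmax_leqP => i _.
  rewrite (leq_trans (size_scale_leq _ _)) // twist_size.
  by rewrite ltn_exp2l //; lia.
apply: (Ocl (twist A B p d + h)).
- by rewrite monicE lead_coefDl // (monicP (twist_monic d)).
- rewrite rpredD ?twist_over // polyOverZ // rpredD ?polyOverC //.
  by apply: rpred_sum => i _; rewrite polyOverZ ?twist_over ?mO.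
rewrite /root hornerD hornerZ hornerD hornerC horner_sum.
under eq_bigr => i _ do rewrite hornerZ.
apply/eqP; apply: (mulfI c0).
by rewrite mulr0 mulrDr [c * (c^-1 * _)]mulrA divff // mul1r addrC sum0.
Qed.
End Twist.

(** * Iterates of a family of Drinfeld modules *)

Lemma double_card_le_expn (F : finFieldType) r :
  (1 < r)%N -> (2 * #|F| <= #|F| ^ r)%N.
Proof.
have q_gt1 := finRing_gt1 F => r_gt1.
apply: leq_trans (leq_pexp2l _ r_gt1); last exact: ltnW.
by rewrite expnS expn1 leq_mul2r q_gt1 orbT.
Qed.

Section Dynamics.
Variables (F : finFieldType) (L : fieldType) (e : {rmorphism F -> L}).
Variables (tau : L) (r : nat).
Hypothesis r_gt1 : (1 < r)%N.
Let q := #|F|.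
Let D := (q ^ r)%N.

(** The value at x of the Drinfeld module with parameter lam, at t. *)
Definition drinfeld_map (lam x : L) := tau * x + lam * x ^+ q + x ^+ D.

Lemma pnat_card n : [pchar L].-nat (q ^ n)%N.
Proof.
have [p p_pr pF] := finPcharP F.
have pL : p \in [pchar L] := rmorph_pchar e pF.
rewrite pnatX; apply/orP; left.
by rewrite (eq_pnat _ (pcharf_eq pL)) /q (card_pprimeChar pF) pnatX pnat_id.
Qed.

Lemma const_expX c n : e c ^+ (q ^ n) = e c.
Proof.
rewrite -rmorphXn; congr (e _).
by elim: n => [|n IH]; rewrite ?expr1 // expnSr exprM IH expf_card.
Qed.

Lemma drinfeld_map_linear lam c x y :
  drinfeld_map lam (e c * x + y)
    = e c * drinfeld_map lam x + drinfeld_map lam y.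
Proof.
have frob n : (e c * x + y) ^+ (q ^ n) = e c * x ^+ (q ^ n) + y ^+ (q ^ n).
  by rewrite exprDn_pchar ?pnat_card // exprMn const_expX.
by have := frob 1; rewrite expn1 /drinfeld_map /D frob => ->; ring.
Qed.

Lemma iter_drinfeld_map_linear lam n c x y :
  iter n (drinfeld_map lam) (e c * x + y)
    = e c * iter n (drinfeld_map lam) x + iter n (drinfeld_map lam) y.
Proof. by elim: n => //= n ->; rewrite drinfeld_map_linear. Qed.

Definition annihilates (Q : {poly F}) lam x :=
  \sum_(i < size Q) e Q`_i * iter i (drinfeld_map lam) x = 0.

Definition orbit_torsion lam x :=
  exists2 Q : {poly F}, Q != 0 & annihilates Q lam x.

Lemma orbit_torsion_iter lam n x :
  orbit_torsion lam x -> orbit_torsion lam (iter n (drinfeld_map lam) x).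
Proof.
have it0 : iter n (drinfeld_map lam) 0 = 0.
  elim: n => //= n ->; rewrite /drinfeld_map mulr0 !expr0n /q /D expn_eq0.
  by rewrite (gtn_eqF (ltnW (finRing_gt1 F))) /= mulr0 !addr0.
case=> Q Q0 Qx; exists Q => //; rewrite /annihilates.
rewrite -[RHS]it0 -[in RHS]Qx.
elim: (size Q) => [|m IH]; first by rewrite !big_ord0 it0.
rewrite !big_ord_recr /= addrC IH [in RHS]addrC iter_drinfeld_map_linear.
by rewrite -!iterD addnC.
Qed.

(** The iterates of a as polynomials in the parameter. *)
Fixpoint orbit_poly (a : L) n : {poly L} :=
  if n is n'.+1 then
    orbit_poly a n' ^+ D + ('X * orbit_poly a n' ^+ q + tau *: orbit_poly a n')
  else a%:P.

Lemma orbit_polyE a n lam : (orbit_poly a n).[lam] = iter n (drinfeld_map lam) a.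
Proof.
elim: n => [|n IH]; first by rewrite hornerC.
rewrite iterS {2}/drinfeld_map /= !hornerD hornerM hornerX hornerZ.
rewrite !horner_exp IH.
by rewrite [RHS]addrC [tau * _ + _]addrC.
Qed.

Let q_gt1 : (1 < q)%N. Proof. exact: finRing_gt1. Qed.
Let q2_le_D : (2 * q <= D)%N. Proof. exact: double_card_le_expn. Qed.
Let D_gt0 : (0 < D)%N. Proof. lia. Qed.

(** The shift by one is essential: the orbit starts with the constant a, and
    the degree becomes positive only at the first step, where the leading
    coefficient a ^ q appears. *)
Lemma orbit_poly_size a n : a != 0 ->
  size (orbit_poly a n.+1) = (D ^ n).+1 /\
  lead_coef (orbit_poly a n.+1) = a ^+ (q * D ^ n).
Proof.
move=> a0; elim: n => [|n [IHs IHl]].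
  have aq0 : a ^+ q != 0 by rewrite expf_neq0.
  have -> : orbit_poly a 1 = a ^+ q *: 'X + (a ^+ D + tau * a)%:P.
    by rewrite /= -!mul_polyC polyCD !polyCM !rmorphXn /=; ring.
  have s1 : size (a ^+ q *: 'X) = 2 by rewrite size_scale // size_polyX.
  rewrite size_polyDl ?lead_coefDl s1 ?lead_coefZ ?lead_coefX;
    rewrite ?(leq_ltn_trans (size_polyC_leq1 _)) //.
  by rewrite expn0 muln1 mulr1.
have Dn : (0 < D ^ n)%N by rewrite expn_gt0 D_gt0.
have sz : size (orbit_poly a n.+1) = (D ^ n).-1.+2 by rewrite prednK.
have [|sE lE] := size_lead_step q_gt1 q2_le_D (A := 'X) tau sz.
  by rewrite size_polyX.
by rewrite sE lE prednK // IHl -exprM -mulnA -expnSr.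
Qed.
End Dynamics.

(** * Integrality of torsion parameters and of torsion orbits *)

Section Bounds.
Variables (F : finFieldType) (L : fieldType) (e : {rmorphism F -> L}).
Variables (tau : L) (r : nat).
Hypothesis r_gt1 : (1 < r)%N.
Let q := #|F|.
Let D := (q ^ r)%N.
Let q_gt1 : (1 < q)%N. Proof. exact: finRing_gt1. Qed.
Let q2_le_D : (2 * q <= D)%N. Proof. exact: double_card_le_expn. Qed.
Let D_gt0 : (0 < D)%N. Proof. lia. Qed.
Let le_qD : (q <= D)%N. Proof. lia. Qed.
Let le2_Dq : (2 <= D - q)%N. Proof. lia. Qed.
Let le1_Dq : (1 <= D - q)%N. Proof. lia. Qed.
Let D_gt1 : (0 < D - 1)%N. Proof. lia. Qed.

Notation phi := (drinfeld_map F tau r).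
Notation orbit_torsion := (orbit_torsion e tau r).

Variables (O : subringClosed L) (Ocl : int_closed O).

(** Constants are roots of X ^ q - X. *)
Lemma const_int c : e c \in O.
Proof.
have sX : (size ('X : {poly L})%R < size ('X^q : {poly L})%R)%N.
  by rewrite size_polyX size_polyXn.
apply: (Ocl (p := 'X^q - 'X)).
- by rewrite monicE lead_coefDl ?size_polyN // lead_coefXn.
- by rewrite rpredB ?rpredX ?polyOverX.
by rewrite /root !hornerE -rmorphXn expf_card subrr.
Qed.

Lemma expr_tower (w : L) n :
  [/\ w ^+ (D ^ n.+1) = (w ^+ (D ^ n)) ^+ D,
      w ^+ (D ^ n.+1) = w ^+ (D ^ n * (D - q)) * (w ^+ (D ^ n)) ^+ q
    & w ^+ (D ^ n.+1) = w ^+ (D ^ n * (D - 1)) * w ^+ (D ^ n)].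
Proof.
split; first by rewrite -exprM expnSr.
  by rewrite -exprM -exprD -mulnDr subnK ?expnSr.
by rewrite -exprD -mulnSr subn1 prednK // expnSr.
Qed.

(** A point larger than 1, t and the parameter escapes to infinity under
    iteration, so a torsion point is no larger. Algebraically, an annihilating
    combination of iterates of x is, up to a unit and in the variable s x, a
    monic polynomial with coefficients in O. *)
Lemma orbit_torsion_int s lam x : s \in O -> s * tau \in O -> s * lam \in O ->
  orbit_torsion lam x -> s * x \in O.
Proof.
move=> sO stO slO [Q Q0 Qx].
have [s0|s0] := eqVneq s 0; first by rewrite s0 mul0r rpred0.
pose A n := (s ^+ (D ^ n * (D - q)) * lam)%:P : {poly L}.
pose B n := s ^+ (D ^ n * (D - 1)) * tau.
have Dn n : (0 < D ^ n)%N by rewrite expn_gt0 D_gt0.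
have pow m x' : (0 < m)%N -> s * x' \in O -> s ^+ m * x' \in O.
  by case: m => // m _ sx; rewrite exprSr -mulrA rpredM ?rpredX.
have AO n : A n \is a polyOver O.
  by rewrite polyOverC pow // muln_gt0 Dn.
have BO n : B n \in O by rewrite pow // muln_gt0 Dn.
have sA n : (size (A n) <= 2)%N.
  by rewrite (leq_trans (size_polyC_leq1 _)).
have twE n : (twist q D A B 'X n).[s * x] = s ^+ (D ^ n) * iter n (phi lam) x.
  elim: n => [|n IH] /=; first by rewrite hornerX expr1.
  have [E1 E2 E3] := expr_tower s n.
  rewrite hornerD horner_exp hornerD hornerM hornerZ hornerC horner_exp IH.
  set y := iter n _ x; rewrite [in RHS]/drinfeld_map -/q -/D !mulrDr.
  rewrite [X in _ = X * _ + _ + _]E3 [X in _ = _ + X * _ + _]E2 E1 /B !exprMn.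
  by ring.
have sQ : size Q = (size Q).-1.+1 by rewrite prednK // size_poly_gt0.
set d := (size Q).-1 in sQ.
have Qd : Q`_d != 0 by rewrite -lead_coefE lead_coef_eq0.
apply: (@twist_root L q D q_gt1 q2_le_D O A B 'X sA (size_polyX _) (monicX _)
  (polyOverX _) AO BO (e Q`_d) 0 (fun i => e Q`_i * s ^+ (D ^ d - D ^ i)) d).
- exact: Ocl.
- by rewrite -fmorphV const_int.
- by rewrite fmorph_eq0.
- exact: rpred0.
- by move=> i _; rewrite rpredM ?const_int ?rpredX.
have : s ^+ (D ^ d) * (\sum_(i < size Q) e Q`_i * iter i (phi lam) x) = 0.
  by rewrite Qx mulr0.
rewrite sQ big_ord_recr /= mulrDr mulr_sumr twE add0r => sum0.
rewrite -[RHS]sum0; congr (_ + _); last by rewrite mulrCA.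
apply: eq_bigr => i _; rewrite twE mulrA -[_ * _ * s ^+ _]mulrA -exprD subnK.
  by rewrite mulrAC mulrC mulrA.
by rewrite leq_pexp2l // ltnW.
Qed.

Section SpecialValues.
Variables (s a : L).
Hypotheses (a0 : a != 0) (sO : s \in O) (stO : s * tau \in O).
Hypotheses (saO : s * a \in O) (saVO : s * a^-1 \in O).

Let h := s ^+ D / a ^+ q.

(** The same argument with the parameter as the variable. The n-th iterate of a
    has degree D ^ (n - 1) in lam and leading coefficient a ^ (q D ^ (n - 1)); so
    with h = s ^ D / a ^ q, multiplying it by h ^ (D ^ (n - 1)) makes it monic in
    s ^ D lam. The power s ^ D is large enough to absorb all the denominators
    that come from the powers of 1 / a and of t. *)
Lemma torsion_parameter_int lam : orbit_torsion lam a -> s ^+ D * lam \in O.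
Proof.
case=> Q Q0 Qa.
have [s0|s0] := eqVneq s 0.
  by rewrite s0 expr0n (gtn_eqF D_gt0) mul0r rpred0.
have sE m n : (n <= m)%N -> s ^+ m = s ^+ (m - n) * s ^+ n.
  by move=> le_nm; rewrite -exprD subnK.
have hE : h = s ^+ (D - q) * (s * a^-1) ^+ q.
  by rewrite /h (sE D q) ?exprMn ?exprVn ?mulrA.
have hO : h \in O by rewrite hE rpredM ?rpredX.
have htO : h * tau \in O.
  have -> : h * tau = s ^+ (D - q - 1) * (s * a^-1) ^+ q * (s * tau).
    by rewrite hE (sE _ _ le1_Dq) expr1; ring.
  by rewrite rpredM // rpredM // ?rpredM ?rpredX.
have haO : h * a \in O.
  have -> : h * a = s ^+ (D - q - 1) * (s * a^-1) ^+ q * (s * a).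
    by rewrite hE (sE _ _ le1_Dq) expr1; ring.
  by rewrite rpredM // rpredM // ?rpredM ?rpredX.
have htaO : h * (tau * a) \in O.
  have -> : h * (tau * a)
      = s ^+ (D - q - 2) * (s * a^-1) ^+ q * (s * a) * (s * tau).
    by rewrite hE (sE _ _ le2_Dq) expr2; ring.
  by rewrite rpredM // rpredM // ?rpredM ?rpredX.
have haDO : h * a ^+ D \in O.
  have -> : h * a ^+ D = s ^+ q * (s * a) ^+ (D - q).
    have aq0 : a ^+ q != 0 by rewrite expf_neq0.
    rewrite /h (sE _ _ le_qD).
    have -> : a ^+ D = a ^+ (D - q) * a ^+ q by rewrite -exprD subnK.
    by rewrite exprMn; field.
  by rewrite rpredM ?rpredX.
(* The coefficient of degree 1 contains lam = (s ^ D lam) / s ^ D; the exponent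
   D ^ n (D - q) of h that comes with it is at least 2, which suffices to cancel
   the division by s ^ D. *)
have h2O : h ^+ 2 / s ^+ D \in O.
  have -> : h ^+ 2 / s ^+ D = s ^+ (D - 2 * q) * (s * a^-1) ^+ (2 * q).
    have aq0 : a ^+ q != 0 by rewrite expf_neq0.
    have sD0 : s ^+ D != 0 by rewrite expf_neq0.
    rewrite [(s * _) ^+ _]exprMn mulrA -exprD subnK // exprVn [(2 * q)%N]mulnC.
    by rewrite exprM /h; field; rewrite aq0 sD0.
  by rewrite rpredM ?rpredX.
have powM m n x : (n <= m)%N -> h ^+ n * x \in O -> h ^+ m * x \in O.
  by move=> le_nm hx; rewrite -(subnK le_nm) exprD -mulrA rpredM ?rpredX.
have Dn n : (0 < D ^ n)%N by rewrite expn_gt0 D_gt0.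
(* The scaled form of the first iterate, in the variable s ^ D lam. *)
pose p0 : {poly L} := 'X + (h * (tau * a) + h * a ^+ D)%:P.
pose A n : {poly L} := (h ^+ (D ^ n * (D - q)) / s ^+ D) *: 'X.
pose B n := h ^+ (D ^ n * (D - 1)) * tau.
have sp0 : size p0 = 2.
  by rewrite size_polyDl ?size_polyX // (leq_ltn_trans (size_polyC_leq1 _)).
have mp0 : p0 \is monic.
  by rewrite monicE lead_coefDl ?lead_coefX // size_polyX
    (leq_ltn_trans (size_polyC_leq1 _)).
have p0O : p0 \is a polyOver O by rewrite rpredD ?polyOverX // polyOverC rpredD.
have AO n : A n \is a polyOver O.
  rewrite polyOverZ ?polyOverX // (powM _ 2%N) //.
  by rewrite (leq_trans le2_Dq) // leq_pmull.
have BO n : B n \in O.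
  by rewrite /B (powM _ 1%N) ?expr1 // muln_gt0 Dn.
have sA n : (size (A n) <= 2)%N.
  by rewrite (leq_trans (size_scale_leq _ _)) ?size_polyX.
have sD0 : s ^+ D != 0 by rewrite expf_neq0.
have haq : h * a ^+ q = s ^+ D by rewrite /h divfK // expf_neq0.
have twE n : (twist q D A B p0 n).[s ^+ D * lam]
    = h ^+ (D ^ n) * iter n.+1 (phi lam) a.
  elim: n => [|n].
    rewrite /= hornerD hornerX hornerC expn0 expr1 /drinfeld_map -/q -/D -haq.
    ring.
  rewrite -[iter n.+2 _ _]/(phi lam (iter n.+1 (phi lam) a)).
  move: (iter n.+1 (phi lam) a) => y IH.
  have [E1 E2 E3] := expr_tower h n.
  rewrite [twist _ _ _ _ _ _]/= hornerD horner_exp hornerD hornerM !hornerZ.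
  rewrite hornerX horner_exp IH.
  rewrite [in RHS]/drinfeld_map -/q -/D !mulrDr.
  rewrite [X in _ = X * _ + _ + _]E3 [X in _ = _ + X * _ + _]E2 E1 /B !exprMn.
  by field.
have sQ : size Q = (size Q).-1.+1 by rewrite prednK // size_poly_gt0.
set d := (size Q).-1 in sQ.
have Qd : Q`_d != 0 by rewrite -lead_coefE lead_coef_eq0.
(* If Q is a nonzero constant then a = 0. *)
case: d => [|d] in sQ Qd.
  move/eqP: Qa; rewrite /annihilates sQ big_ord1 /= mulf_eq0 fmorph_eq0.
  by rewrite (negPf Qd) (negPf a0).
apply: (@twist_root L q D q_gt1 q2_le_D O A B p0 sA sp0 mp0
  p0O AO BO (e Q`_d.+1) (e Q`_0 * (h ^+ (D ^ d) * a))
  (fun i => e Q`_i.+1 * h ^+ (D ^ d - D ^ i)) d).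
- exact: Ocl.
- by rewrite -fmorphV const_int.
- by rewrite fmorph_eq0.
- by rewrite rpredM ?const_int // (powM _ 1%N) ?expr1.
- by move=> i _; rewrite rpredM ?const_int ?rpredX.
have : h ^+ (D ^ d) * (\sum_(i < size Q) e Q`_i * iter i (phi lam) a) = 0.
  by rewrite Qa mulr0.
rewrite sQ big_ord_recr big_ord_recl /= mulrDr mulrDr mulr_sumr twE => sum0.
rewrite -[RHS]sum0; congr (_ + _ + _); last by rewrite mulrCA.
  by rewrite mulrCA.
apply: eq_bigr => i _; rewrite twE mulrA -[_ * _ * h ^+ _]mulrA -exprD subnK.
  by rewrite mulrAC mulrC mulrA.
by rewrite leq_pexp2l // ltnW.
Qed.

(** The bound depends neither on the position in the orbit nor on the
    parameter; this uniformity is what the determinant estimate needs. *)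
Lemma orbit_int lam n : orbit_torsion lam a -> s ^+ D * iter n (phi lam) a \in O.
Proof.
move=> lam_a; apply: (@orbit_torsion_int _ lam); first by rewrite rpredX.
- by rewrite -(prednK D_gt0) exprSr -mulrA rpredM ?rpredX.
- exact: torsion_parameter_int.
- exact: orbit_torsion_iter.
Qed.
End SpecialValues.
End Bounds.

(** * A determinant bound for torsion parameters *)

(** The matrix is the product of the triangular matrix of coefficients of the P j
    with the Vandermonde matrix. *)
Lemma det_horner (L : comNzRingType) n (P : 'I_n -> {poly L}) (x : 'rV[L]_n) :
  (forall j, size (P j) = j.+1) ->
  \det (\matrix_(j, i) (P j).[x 0 i])
    = (\prod_j lead_coef (P j)) * \det (Vandermonde n x).
Proof.
move=> sP; pose T := \matrix_(j < n, l < n) (P j)`_l.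
have -> : \matrix_(j, i) (P j).[x 0 i] = T *m Vandermonde n x.
  apply/matrixP => j i; rewrite !mxE (horner_coef_wide _ (n := n)) ?sP //.
  by apply: eq_bigr => l _; rewrite !mxE.
rewrite det_mulmx det_trig.
  by congr (_ * _); apply: eq_bigr => j _; rewrite mxE lead_coefE sP.
by apply/is_trig_mxP => j l lt_jl; rewrite mxE nth_default // sP.
Qed.

Lemma det_over (L : comNzRingType) (O : subringClosed L) n (M : 'M[L]_n) :
  (forall i j, M i j \in O) -> \det M \in O.
Proof.
by move=> MO; apply: rpred_sum => p _; rewrite rpredMsign; apply: rpred_prod.
Qed.

Section DeterminantBound.
Variables (F : finFieldType) (L : fieldType) (e : {rmorphism F -> L}).
Variables (tau : L) (r : nat).
Hypothesis r_gt1 : (1 < r)%N.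
Let q := #|F|.
Let D := (q ^ r)%N.
Let D_gt0 : (0 < D)%N.
Proof. by rewrite expn_gt0 ltnW // finRing_gt1. Qed.

Variables (O : subringClosed L) (Ocl : int_closed O) (s a : L).
Hypotheses (a0 : a != 0) (sO : s \in O) (stO : s * tau \in O).
Hypotheses (saO : s * a \in O) (saVO : s * a^-1 \in O).

(** Polynomials of each degree j < D ^ m that are small at all torsion
    parameters: multiply together the orbit polynomials, of degrees D ^ i, with
    the base D digits of j as exponents. There are at most m D factors, each of
    which is made integral by s ^ D. *)
Lemma small_basis m j : (j < D ^ m)%N -> exists p : {poly L},
  [/\ size p = j.+1, lead_coef p = a ^+ (q * j) &
      forall lam, orbit_torsion e tau r lam a ->
        s ^+ (D * (m * D)) * p.[lam] \in O].
Proof.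
elim: m j => [|m IH] j lt_j.
  exists 1; rewrite size_poly1 lead_coef1; case: j lt_j => // _.
  by split=> // [|lam _]; rewrite muln0 // hornerC mulr1 rpred1.
have Dm : (0 < D ^ m)%N by rewrite expn_gt0 D_gt0.
have [p [sp lp pO]] := IH _ (ltn_pmod j Dm).
have [sf lf] := orbit_poly_size F tau r_gt1 m a0.
set f := orbit_poly _ _ _ _ _ in sf lf.
set d := (j %/ D ^ m)%N.
have lt_d : (d < D)%N by rewrite ltn_divLR // -expnS.
have f0 : f != 0 by rewrite -size_poly_gt0 sf.
have p0 : p != 0 by rewrite -size_poly_gt0 sp.
have sfd : size (f ^+ d) = (d * D ^ m).+1.
  have fd0 : f ^+ d != 0 by rewrite expf_neq0.
  by rewrite -[LHS]prednK ?size_poly_gt0 // size_exp sf mulnC.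
exists (f ^+ d * p); split.
- rewrite size_mul // ?expf_neq0 // sfd sp addSn addnS /=.
  by rewrite -divn_eq.
- rewrite lead_coefM lead_coef_exp lf lp -exprM -exprD; congr (_ ^+ _).
  by rewrite [in RHS](divn_eq j (D ^ m)) -/d mulnDr [(d * _)%N]mulnC mulnA.
move=> lam lam_a; rewrite hornerM horner_exp orbit_polyE.
have -> : (D * (m.+1 * D) = D * (D - d) + D * d + D * (m * D))%N.
  by rewrite -mulnDr subnK ?(ltnW lt_d) // -mulnDr mulSn.
set y := iter _ _ a.
have -> : s ^+ (D * (D - d) + D * d + D * (m * D)) * (y ^+ d * p.[lam])
   = s ^+ (D * (D - d)) * (s ^+ D * y) ^+ d * (s ^+ (D * (m * D)) * p.[lam]).
  by rewrite !exprD exprMn -exprM; ring.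
rewrite rpredM ?pO // rpredM ?rpredX //.
exact: orbit_int lam_a.
Qed.

(** Evaluate the small basis at the parameters. The exponent of s is of order
    N log N with N = D ^ m, while that of a is of order N ^ 2, so the factor
    contributed by s is negligible. *)
Lemma torsion_vandermonde_int m (lam : 'rV[L]_(D ^ m)) :
  (forall i, orbit_torsion e tau r (lam 0 i) a) ->
  s ^+ (D * (m * D) * D ^ m) *
    (a ^+ (\sum_(j < D ^ m) q * j) * \det (Vandermonde (D ^ m) lam)) \in O.
Proof.
move=> lam_a.
have /fin_all_exists [P hP] (j : 'I_(D ^ m)) : exists p : {poly L},
  [/\ size p = j.+1, lead_coef p = a ^+ (q * j) &
      forall lam, orbit_torsion e tau r lam a ->
        s ^+ (D * (m * D)) * p.[lam] \in O].
  exact: small_basis.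
have -> : a ^+ (\sum_(j < D ^ m) q * j) = \prod_j lead_coef (P j).
  rewrite expr_sum; apply: eq_bigr => j _; by case: (hP j).
rewrite -det_horner; last by move=> j; case: (hP j).
rewrite exprM -detZ; apply: det_over => j i; rewrite !mxE.
by case: (hP j) => _ _; apply.
Qed.
End DeterminantBound.

(** * Drinfeld modules as iterated maps *)

Lemma infinite_uniq_seq (T : choiceType) (A : set T) n : infinite_set A ->
  exists s : seq T, [/\ uniq s, size s = n & forall x, x \in s -> A x].
Proof.
move=> /(@infinite_set_fset _ _ n)[B BA nB]; exists (take n (enum_fset B)).
split; first by rewrite take_uniq // fset_uniq.
  by rewrite size_takel.
by move=> x /mem_take xB; apply: BA.
Qed.

Section Module.
Variables (F : finFieldType) (L : fieldType).
Variable gamma : {rmorphism {fraction {poly F}} -> L}.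
Variables (r : nat) (Psi : drinfeld_module gamma r).

Let act (Q : {poly F}) (x : L) := (Ga_poly (Psi Q)).[x].

Lemma actD P Q x : act (P + Q) x = act P x + act Q x.
Proof. by rewrite /act rmorphD /= hornerD. Qed.

Lemma actM P Q x : act (P * Q) x = act P (act Q x).
Proof. by rewrite /act rmorphM /= horner_comp. Qed.

Lemma actC c x : act c%:P x = const_emb gamma c * x.
Proof. by rewrite /act drinfeld_const hornerZ hornerX. Qed.

Lemma act_0r Q : act Q 0 = 0.
Proof.
have act00 : act 0 0 = 0 by rewrite -polyC0 actC mulr0.
by rewrite -{1}act00 -actM mulr0.
Qed.

Lemma act_iter Q x : act Q x =
  \sum_(i < size Q) const_emb gamma Q`_i * iter i (act 'X) x.
Proof.
have actXn n : act 'X^n x = iter n (act 'X) x.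
  elim: n => [|n IH]; first by rewrite expr0 -polyC1 actC rmorph1 mul1r.
  by rewrite exprS actM IH.
rewrite -{1}[Q]coefK poly_def.
rewrite (big_morph (act^~ x) (fun P R => actD P R x) (_ : act 0 x = 0)).
  by apply: eq_bigr => i _; rewrite -mul_polyC actM actC actXn.
by rewrite -polyC0 actC rmorph0 mul0r.
Qed.
End Module.

Section Specialization.
Variables (F : finFieldType) (K : fieldType) (L : closedFieldType).
Variable gamma : {rmorphism {fraction {poly F}} -> K}.
Variable iota : {rmorphism K -> L}.
Variable r : nat.
Hypothesis r_gt1 : (1 < r)%N.

Definition const_L : {rmorphism F -> L} := const_emb (iota \o gamma).
Definition t_L : L := t_emb (iota \o gamma).
Notation Psi := (Phi_spec gamma iota r).

Lemma Phi_spec_iter lam Q x : (Ga_poly (Psi lam Q)).[x] =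
  \sum_(i < size Q) const_L Q`_i * iter i (drinfeld_map F t_L r lam) x.
Proof.
rewrite act_iter; apply: eq_bigr => i _; congr (_ * _).
apply: eq_iter => y.
by rewrite Phi_spec_t // !(hornerD, hornerZ, hornerX, hornerXn).
Qed.

Lemma torsionE lam x :
  torsion (Psi lam) x <-> orbit_torsion const_L t_L r lam x.
Proof.
split=> -[Q Q0 Qx]; exists Q => //.
  by rewrite /annihilates -Phi_spec_iter.
by rewrite Phi_spec_iter.
Qed.

Lemma torsion_scale lam c x y :
  x = const_L c * y -> torsion (Psi lam) y -> torsion (Psi lam) x.
Proof.
move=> -> [Q Q0 Qy]; exists Q => //.
have := actM (Psi lam) Q c%:P y; rewrite actC => <-.
by rewrite mulrC actM Qy act_0r.
Qed.

(** If there were finitely many such parameters, some Q would kill b at all of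
    them. The value at b of 1 + t Q is a nonconstant polynomial in the parameter;
    at a root lam of it, both 1 + t Q and Q kill b, so that b = 0. *)
Lemma torsion_infinite (b : L) :
  infinite_set [set lam | torsion (Psi lam) b].
Proof.
move=> /finite_seqP[s sE].
have inS lam : torsion (Psi lam) b -> lam \in s.
  by move=> h; have : [set lam | torsion (Psi lam) b] lam by []; rewrite sE.
have inT lam : lam \in s -> torsion (Psi lam) b.
  by move=> h; have : [set` s] lam by []; rewrite -sE.
have [b0|b0] := eqVneq b 0.
  have ts lam : lam \in s.
    by apply: inS; exists 1; rewrite ?oner_neq0 // b0 act_0r.
  have s_gt0 : (0 < size s)%N by case: (s) (ts 0).
  have /closed_rootP[z] : size (\prod_(x <- s) ('X - x%:P) + 1 : {poly L}) != 1.
    rewrite size_polyDl ?size_prod_XsubC ?size_poly1 //.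
    by rewrite eqSS -lt0n.
  have /rootP pz : root (\prod_(x <- s) ('X - x%:P)) z.
    by rewrite root_prod_XsubC ts.
  by rewrite /root hornerD hornerC pz add0r oner_eq0.
have [Q Q0 Qs] : exists2 Q : {poly F}, Q != 0 &
    forall lam, lam \in s -> (Ga_poly (Psi lam Q)).[b] = 0.
  elim: s {sE inS} inT => [|l s IH] inT; first by exists 1; rewrite ?oner_neq0.
  have [|Q Q0 Qs] := IH.
    by move=> lam ls; apply: inT; rewrite inE ls orbT.
  have [R R0 Rl] := inT l (mem_head _ _).
  exists (Q * R); first by rewrite mulf_neq0.
  move=> lam; rewrite inE => /predU1P[->|ls]; first by rewrite actM Rl act_0r.
  by rewrite mulrC actM Qs // act_0r.
pose P := 'X * Q + 1.
have sP : (1 < size P)%N.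
  rewrite size_polyDl mulrC size_mulX // ?size_poly1 ltnS size_poly_gt0 //.
have P0 : P != 0 by rewrite -size_poly_gt0 ltnW.
have [d dE] : exists d, size P = d.+2.
  by case: (size P) sP => [|[|d]] // _; exists d.
pose f := \sum_(i < size P) const_L P`_i *: orbit_poly F t_L r b i.
have fE lam : f.[lam] = (Ga_poly (Psi lam P)).[b].
  rewrite Phi_spec_iter horner_sum; apply: eq_bigr => i _.
  by rewrite hornerZ orbit_polyE.
have D_gt1 : (1 < #|F| ^ r)%N.
  by rewrite -(expn0 #|F|) ltn_exp2l ?finRing_gt1 // ltnW.
have sf : size f = ((#|F| ^ r) ^ d).+1.
  have cP : const_L P`_d.+1 != 0.
    by rewrite fmorph_eq0 -[d.+1]/(d.+2.-1) -dE -lead_coefE lead_coef_eq0.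
  have [so _] := orbit_poly_size F t_L r_gt1 d b0.
  rewrite /f dE big_ord_recr /= addrC size_polyDl size_scale // so //.
  rewrite ltnS (leq_trans (size_sum _ _ _)) //.
  apply/bigmax_leqP => -[[|i] lt_i] _ /=.
    rewrite (leq_trans (size_scale_leq _ _)) //.
    by rewrite (leq_trans (size_polyC_leq1 _)) // expn_gt0 ltnW.
  rewrite (leq_trans (size_scale_leq _ _)) //.
  have [-> _] := orbit_poly_size F t_L r_gt1 i b0.
  by rewrite ltn_exp2l.
have /closed_rootP[z /rootP fz] : size f != 1.
  by rewrite sf eqSS -lt0n expn_gt0 ltnW.
have zs : z \in s by apply: inS; exists P; rewrite -?fE.
have : (Ga_poly (Psi z P)).[b] = b.
  by rewrite actD actM Qs // act_0r add0r -polyC1 actC rmorph1 mul1r.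
by rewrite -fE fz => b00; rewrite -b00 eqxx in b0.
Qed.
End Specialization.

(** * Linear independence forces finiteness *)

(** With N = D ^ m, this compares N log N with N ^ 2. *)
Lemma quadratic_beats_linear q D c : (1 < q)%N -> (3 < D)%N ->
  exists m, (c * (D * (m * D) * D ^ m) < \sum_(j < D ^ m) q * j)%N.
Proof.
move=> q_gt1 D_gt3; pose K := (c * D * D)%N; exists K.+1.
have big : (K * K.+1 + 1 < D ^ K.+1)%N.
  have h : (K.+1 < 2 ^ K.+1)%N by apply: ltn_expl.
  have : (2 ^ K.+1 * 2 ^ K.+1 <= D ^ K.+1)%N by rewrite -expnMn leq_exp2r.
  by move: (2 ^ K.+1)%N (D ^ K.+1)%N h => x y; nia.
have sum2 N : (\sum_(j < N) q * j >= N * (N - 1))%N.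
  elim: N => [|N IH]; first by rewrite big_ord0.
  rewrite big_ord_recr /=; move: IH; set S := (\sum_(_ < _) _)%N => IH.
  have : (2 * N <= q * N)%N by rewrite leq_mul2r q_gt1 orbT.
  by move: (q * N)%N => x; nia.
apply: leq_trans (sum2 _); move: big; move: (D ^ K.+1)%N => N big.
have -> : (c * (D * (K.+1 * D) * N) = K * K.+1 * N)%N by rewrite /K; ring.
by rewrite mulnC ltn_mul2l; lia.
Qed.

Section Independent.
Variables (F : finFieldType) (K : fieldType) (L : closedFieldType).
Variable gamma : {rmorphism {fraction {poly F}} -> K}.
Variable iota : {rmorphism K -> L}.
Variable r : nat.
Hypothesis r_gt1 : (1 < r)%N.
Notation Psi := (Phi_spec gamma iota r).
Notation t_L := (t_L gamma iota).
Notation const_L := (const_L gamma iota).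

(** The bound for b is used at the finite places of k(u) and the bound for a at
    infinity, where a = u b is the larger of the two. *)
Lemma transc_ratio_finite (a b : L) : a != 0 -> b != 0 ->
  transc const_L (a / b) ->
  ~ infinite_set [set lam | torsion (Psi lam) a /\ torsion (Psi lam) b].
Proof.
move=> a0 b0 tu0; set u := a / b in tu0.
have [k [j [_ tu alg]]] :=
  transc_extend_seq [:: 1; t_L; a; a^-1; b; b^-1] tu0.
have u0 := transc_neq0 tu.
have [s [c [s0 sP]]] := common_mult tu alg.
set sg := ev j u s in sP; set sg' := u^-1 ^+ c * sg in sP.
have sg0 : sg != 0 by rewrite transc_ev_neq0.
have sPn i (lt_i : (i < 6)%N) :=
  sP _ (mem_nth 0 (lt_i : i < size [:: _; _; _; _; _; _])%N).
have [O1 O1'] := sPn 0 isT; have [Ot Ot'] := sPn 1 isT.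
have [Oa Oa'] := sPn 2 isT; have [OaV OaV'] := sPn 3 isT.
have [Ob Ob'] := sPn 4 isT; have [ObV ObV'] := sPn 5 isT.
rewrite /= in O1 O1' Ot Ot' Oa Oa' OaV OaV' Ob Ob' ObV ObV'.
rewrite !mulr1 in O1 O1'.
have q_gt1 : (1 < #|F|)%N := finRing_gt1 F.
have D_gt3 : (3 < #|F| ^ r)%N.
  apply: (@leq_trans (2 ^ 2)) => //.
  by rewrite (leq_trans (leq_pexp2l _ r_gt1)) // leq_exp2r // ltnW.
have [m mP] := quadratic_beats_linear c q_gt1 D_gt3.
move=> /(@infinite_uniq_seq _ _ ((#|F| ^ r) ^ m))[ls [uls sls lsP]].
pose lam : 'rV[L]_((#|F| ^ r) ^ m) := \row_i ls`_i.
have lamP i : torsion (Psi (lam 0 i)) a /\ torsion (Psi (lam 0 i)) b.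
  by rewrite mxE; apply: lsP; rewrite mem_nth ?sls.
have V0 : \det (Vandermonde ((#|F| ^ r) ^ m) lam) != 0.
  rewrite det_Vandermonde; apply/prodf_neq0 => i _; apply/prodf_neq0 => l lt_il.
  by rewrite !mxE subr_eq0 nth_uniq ?sls // gtn_eqF.
have lam_a i := (torsionE _ _ r_gt1 _ _).1 (lamP i).1.
have lam_b i := (torsionE _ _ r_gt1 _ _).1 (lamP i).2.
have := torsion_vandermonde_int r_gt1 (@int_closure_closed _ _ (ev j u))
  b0 O1 Ot Ob ObV lam_b.
have := torsion_vandermonde_int r_gt1 (@int_closure_closed _ _ (ev j u^-1))
  a0 O1' Ot' Oa' OaV' lam_a.
move: mP V0; move: (\det _) => V.
set M := (\sum_(_ < _) _)%N; set E := (_ * _ * _ ^ m)%N => ltEM V0 O'V OV.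
have : sg ^+ E * (b ^+ M * V) = 0.
  apply: (@liouville _ _ j u tu _ (M - c * E).-1 OV).
  rewrite prednK ?subn_gt0 //.
  suff <- : sg' ^+ E * (a ^+ M * V)
      = u ^+ (M - c * E) * (sg ^+ E * (b ^+ M * V)) by [].
  have aM : a ^+ M = u ^+ M * b ^+ M by rewrite -exprMn divfK.
  have uM : u ^+ M = u ^+ (M - c * E) * u ^+ (c * E).
    by rewrite -exprD subnK // ltnW.
  rewrite /sg' exprMn -exprM exprVn aM uM.
  by have := expf_neq0 (c * E) u0; move: (u ^+ (c * E)) => z z0; field.
move/eqP; rewrite !mulf_eq0 !expf_eq0.
by rewrite (negPf sg0) (negPf b0) (negPf V0) !andbF.
Qed.
End Independent.

Theorem theorem1p4 (F : finFieldType) (r : nat) (hr : (2 <= r)%N)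
  (K : fieldType) (gamma : {rmorphism {fraction {poly F}} -> K})
  (hK : constants_alg_closed gamma)
  (Kbar : closedFieldType) (iota : {rmorphism K -> Kbar})
  (hKbar : forall x : Kbar, algebraicOver iota x)
  (a b : K) :
  infinite_set [set lam : Kbar | torsion (Phi_spec gamma iota r lam) (iota a) /\
                                 torsion (Phi_spec gamma iota r lam) (iota b)]
  <-> lin_dependent2 gamma a b.
Proof.
split=> [inf_ab|[c [d [cd0 cd]]]].
  apply: contrapT => indep.
  have b0 : b != 0.
    apply: contra_notN indep => /eqP->; exists 0, 1.
    by rewrite xpair_eqE oner_eq0 andbF rmorph0 mul0r mulr0 addr0.
  have a0 : a != 0.
    apply: contra_notN indep => /eqP->; exists 1, 0.
    by rewrite xpair_eqE oner_eq0 rmorph0 mul0r mulr0 addr0.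
  have tu : transc (const_L gamma iota) (iota a / iota b).
    move=> [p p0 rp]; apply: indep.
    have [|x xE] := hK (a / b).
      exists p => //; rewrite -fmorph_div /root in rp.
      rewrite (_ : map_poly _ p
        = map_poly iota (map_poly (const_emb gamma) p)) in rp.
        by rewrite horner_map fmorph_eq0 in rp.
      by rewrite -map_poly_comp; apply: eq_map_poly.
    exists 1, (- x); rewrite xpair_eqE oner_eq0; split => //.
    have ab : a = const_emb gamma x * b by rewrite xE divfK.
    by rewrite rmorph1 mul1r rmorphN mulNr {1}ab subrr.
  by apply: (transc_ratio_finite hr _ _ tu inf_ab); rewrite fmorph_eq0.
have scale (x y : K) (c1 d1 : F) : c1 != 0 ->
    const_emb gamma c1 * x + const_emb gamma d1 * y = 0 ->
    exists e, iota x = const_L gamma iota e * iota y.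
  move=> c10 /eqP; rewrite addr_eq0 => /eqP xy; exists (- d1 / c1).
  have -> : const_L gamma iota (- d1 / c1)
      = iota (const_emb gamma (- d1 / c1)) by [].
  rewrite -rmorphM; congr (iota _); apply: (@mulfI _ (const_emb gamma c1)).
    by rewrite fmorph_eq0.
  by rewrite xy mulrA -rmorphM mulrCA divff // mulr1 rmorphN mulNr.
move: cd0; rewrite xpair_eqE negb_and => /orP[c0|d0].
  have [e xE] := scale _ _ _ _ c0 cd.
  move=> fin; apply: (@torsion_infinite _ _ _ gamma iota _ hr (iota b)).
  apply: sub_finite_set fin => lam /= tb.
  by split=> //; apply: torsion_scale xE tb.
rewrite addrC in cd; have [e xE] := scale _ _ _ _ d0 cd.
move=> fin; apply: (@torsion_infinite _ _ _ gamma iota _ hr (iota a)).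
apply: sub_finite_set fin => lam /= ta.
by split=> //; apply: torsion_scale xE ta.
Qed.
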